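(* Let $H$ be a real Hilbert space, $C\subset H$ nonempty closed convex with metric projection $P$, and $A,F:H\to H$ such that: $A$ is linear, self-adjoint, $\lambda$-strongly monotone and $L_A$-Lipschitz continuous; $F$ is $L_F$-Lipschitz continuous; $A,F$ are sequentially weak-to-weak continuous; the couple $(A,F)$ is monotone; $\mathrm{Sol}(A,F,C)\ne\emptyset$ and $\mathcal C:=A(\mathrm{Sol}(A,F,C))$ is convex. Let $\{\alpha_k\},\{\mu_k\},\{h_k\}$ be sequences of positive numbers with $$\sum_{k=0}^\infty h_k\alpha_k=\infty,\quad \lim_{k\to\infty}\mu_kh_k=0,\quad \lim_{k\to\infty}\mu_k\alpha_k=\infty,\quad \lim_{k\to\infty}\frac{|\alpha_k-\alpha_{k+1}|}{h_k\alpha_k^2}=0,\quad \lim_{k\to\infty}\alpha_k=0.$$ Given $x^0\in H$, define for $k\ge0$ $$y^k=P\big(F_{\alpha_k}x^k-\mu_kAx^k\big),\qquad x^{k+1}=x^k+h_k\big(y^k-F_{\alpha_k}x^k\big),$$ where $F_\alpha:=F+\alpha I$. Then $x^k\to x^\dagger$ as $k\to\infty$, where $x^\dagger:=A^{-1}u^\dagger$ and $u^\dagger$ is the unique solution of the problem: find $u\in\mathcal C$ with $\langle A^{-1}u,v-u\rangle\ge0$ for all $v\in\mathcal C$.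
   Context: $\mathrm{GVI}(A,F,C)$: find $x^*\in H$ with $Fx^*\in C$ and $\langle Ax^*,y-Fx^*\rangle\ge0$ for all $y\in C$; $\mathrm{Sol}(A,F,C)$ is its solution set. The couple $(A,F)$ is monotone if $\langle Ax-Ay,Fx-Fy\rangle\ge0$ for all $x,y\in H$. Sequentially weak-to-weak continuous: $x^k\rightharpoonup\bar x$ implies $Ax^k\rightharpoonup A\bar x$. The point $x^\dagger$ belongs to $\mathrm{Sol}(A,F,C)$. *)

(* Defs.v *)
From HB Require Import structures.
From mathcomp Require Import all_boot all_order all_algebra.
From mathcomp Require Import all_classical all_reals all_analysis.
Set Implicit Arguments. Unset Strict Implicit. Unset Printing Implicit Defensive.
Import Order.TTheory GRing.Theory Num.Theory.
Import numFieldNormedType.Exports.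
Local Open Scope classical_set_scope.
Local Open Scope ring_scope.

Section Defs.
Context {R : realType} {V : normedModType R}.

Definition is_inner_product (ip : V -> V -> R) : Prop :=
  (forall x y, ip x y = ip y x) /\
  (forall a x y z, ip (a *: x + y) z = a * ip x z + ip y z) /\
  (forall x, ip x x = `|x| ^+ 2).

Definition convex_set_ (C : set V) : Prop :=
  forall x y (t : R), C x -> C y -> 0 <= t -> t <= 1 -> C (t *: x + (1 - t) *: y).

Definition is_metric_projection (C : set V) (P : V -> V) : Prop :=
  forall x, C (P x) /\ (forall y, C y -> `|x - P x| <= `|x - y|).

Definition is_linear_op (A : V -> V) : Prop :=
  forall (a : R) x y, A (a *: x + y) = a *: A x + A y.

Definition self_adjoint (ip : V -> V -> R) (A : V -> V) : Prop :=
  forall x y, ip (A x) y = ip x (A y).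

Definition strongly_monotone (ip : V -> V -> R) (lam : R) (A : V -> V) : Prop :=
  forall x y, lam * `|x - y| ^+ 2 <= ip (A x - A y) (x - y).

Definition lipschitz_op (L : R) (A : V -> V) : Prop :=
  forall x y, `|A x - A y| <= L * `|x - y|.

Definition weak_cvg (ip : V -> V -> R) (u : nat -> V) (x : V) : Prop :=
  forall z, (fun k => ip (u k) z) @ \oo --> ip x z.

Definition seq_weak_weak_cont (ip : V -> V -> R) (A : V -> V) : Prop :=
  forall (u : nat -> V) x, weak_cvg ip u x -> weak_cvg ip (fun k => A (u k)) (A x).

Definition monotone_couple (ip : V -> V -> R) (A F : V -> V) : Prop :=
  forall x y, 0 <= ip (A x - A y) (F x - F y).

Definition GVI_sol (ip : V -> V -> R) (A F : V -> V) (C : set V) : set V :=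
  [set x | C (F x) /\ forall y, C y -> 0 <= ip (A x) (y - F x)].

(* A^{-1} u: some preimage of u under A (the unique one when A is bijective) *)
Definition inv_op (A : V -> V) (u : V) : V := xget 0 [set x | A x = u].

End Defs.

(* Main.v *)
(** Work in the energy form [<A u, v>], equivalent to the inner product because
    [A] is self-adjoint, bounded and strongly monotone.  One step of the scheme
    at frozen parameters [(alpha, mu, h)] contracts the squared energy distance
    by [1 - h alpha], as soon as [mu h LA <= 1] and
    [(LF + alpha)^2 <= lam mu alpha].  Its fixed point [p alpha] is the solution
    of the regularized problem GVI(A, F_alpha, C).

    Monotonicity of [(A, F)] gives, for [a < b], the inequality
    [E (p a - p b) <= E (p a) - E (p b)] for the squared energy norm [E], so the
    bounded monotone function [a |-> E (p a)] forces [p a] to converge strongly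
    as [a] tends to [0], without any weak compactness.  The limit solves the
    original problem and satisfies the variational inequality that singles out
    [xdag].  Finally the energy norm of [p a - p b] is at most
    [(|a - b| / a) M], so the distance from [x k] to [p (alpha k)] satisfies a
    contraction recursion with perturbation [o (h k * alpha k)], and tends to [0]. *)
Require Import Defs.
From HB Require Import structures.
From mathcomp Require Import all_boot all_order all_algebra.
From mathcomp Require Import all_classical all_reals all_analysis.
From mathcomp Require Import ring lra.
Set Implicit Arguments. Unset Strict Implicit. Unset Printing Implicit Defensive.
Import Order.TTheory GRing.Theory Num.Theory.
Import numFieldNormedType.Exports.
Local Open Scope classical_set_scope.
Local Open Scope ring_scope.

(** * Positive semidefinite forms, covering both the inner product and the energy form *)

Definition psd_form (R : realType) (V : lmodType R) (B : V -> V -> R) :=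
  [/\ forall u v, B u v = B v u,
      forall a u v w, B (a *: u + v) w = a * B u w + B v w
    & forall u, 0 <= B u u].

Section PsdForm.
Context {R : realType} {V : lmodType R} {B : V -> V -> R}.
Hypothesis psdB : psd_form B.

Lemma psdC u v : B u v = B v u. Proof. by case: psdB. Qed.

Lemma psd_ge0 u : 0 <= B u u. Proof. by case: psdB. Qed.

Lemma psdDl u v w : B (u + v) w = B u w + B v w.
Proof. by case: psdB => _ lin _; rewrite -[u]scale1r lin mul1r scale1r. Qed.

Lemma psd0l w : B 0 w = 0.
Proof. by have := psdDl 0 0 w; rewrite addr0 => ?; lra. Qed.

Lemma psdZl a u w : B (a *: u) w = a * B u w.
Proof. by case: psdB => _ lin _; rewrite -[a *: u]addr0 lin psd0l addr0. Qed.

Lemma psdNl u w : B (- u) w = - B u w.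
Proof. by rewrite -scaleN1r psdZl mulN1r. Qed.

Lemma psdDr u v w : B w (u + v) = B w u + B w v.
Proof. by rewrite !(psdC w) psdDl. Qed.

Lemma psdZr a u w : B w (a *: u) = a * B w u.
Proof. by rewrite !(psdC w) psdZl. Qed.

Lemma psdNr u w : B w (- u) = - B w u.
Proof. by rewrite !(psdC w) psdNl. Qed.

Definition psdE := (psdDl, psdDr, psdNl, psdNr, psdZl, psdZr).

Lemma psd_Cauchy_Schwarz u v : B u v ^+ 2 <= B u u * B v v.
Proof.
have Bu := psd_ge0 u; have Bv := psd_ge0 v.
have := psd_ge0 (B v v *: u - B u v *: v).
rewrite !psdE (psdC v u) => ineq.
have [Bv0|Bv0] := eqVneq (B v v) 0; last first.
  have Bv_gt0 : 0 < B v v by rewrite lt0r Bv0.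
  by rewrite -subr_ge0 -(pmulr_rge0 _ Bv_gt0); move: ineq; congr (_ <= _); ring.
have [->|Buv0] := eqVneq (B u v) 0; first by rewrite expr0n/= Bv0 mulr0.
(* The form may be degenerate. When [B v v = 0] and [B u v != 0], this coefficient makes the form
   equal to -1, a contradiction. *)
have := psd_ge0 (u - ((B u u + 1) / (2 * B u v)) *: v).
rewrite !psdE (psdC v u) Bv0 !mulr0 oppr0.
suff -> : (B u u + 1) / (2 * B u v) * B u v = (B u u + 1) / 2 by lra.
by field.
Qed.

Lemma sqrt_psd_triangle u v :
  Num.sqrt (B (u + v) (u + v)) <= Num.sqrt (B u u) + Num.sqrt (B v v).
Proof.
rewrite -(@ler_pXn2r _ 2)// ?nnegrE ?addr_ge0 ?sqrtr_ge0//.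
rewrite sqr_sqrtr ?psd_ge0// sqrrD !sqr_sqrtr ?psd_ge0//.
rewrite !psdE (psdC v u).
suff : B u v <= Num.sqrt (B u u) * Num.sqrt (B v v).
  by rewrite mulr2n; lra.
rewrite -sqrtrM ?psd_ge0//; apply: le_trans (ler_norm _) _.
by rewrite -sqrtr_sqr ler_wsqrtr// psd_Cauchy_Schwarz.
Qed.

End PsdForm.

(** * Inner products and the metric projection *)

Section InnerProduct.
Context {R : realType} {V : normedModType R} {ip : V -> V -> R}.
Hypothesis hip : is_inner_product ip.

Lemma inner_psd : psd_form ip.
Proof. by case: hip => ? [? nE]; split => // u; rewrite nE sqr_ge0. Qed.

Lemma inner_norm u : ip u u = `|u| ^+ 2.
Proof. by case: hip => _ []. Qed.

Lemma inner_le_norm u v : ip u v <= `|u| * `|v|.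
Proof.
apply: le_trans (ler_norm _) _.
rewrite -(@ler_pXn2r _ 2)// ?nnegrE ?mulr_ge0// real_normK ?num_real//.
by rewrite exprMn -!inner_norm (psd_Cauchy_Schwarz inner_psd).
Qed.

Lemma inner_cvg (f g : nat -> V) u v :
  f @ \oo --> u -> g @ \oo --> v -> (fun k => ip (f k) (g k)) @ \oo --> ip u v.
Proof.
have polar a b : ip a b = 4^-1 * (`|a + b| ^+ 2 - `|a - b| ^+ 2).
  by rewrite -!inner_norm !(psdE inner_psd) (psdC inner_psd b a); lra.
move=> fu gv; rewrite polar; under eq_fun do rewrite polar.
have sqr_cvg (w : nat -> V) c : w @ \oo --> c ->
    (fun k => `|w k| ^+ 2) @ \oo --> `|c| ^+ 2.
  by move=> wc; apply: cvgM; exact: cvg_norm.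
by apply: cvgMr; apply: cvgB; apply: sqr_cvg; [exact: cvgD|exact: cvgB].
Qed.

(** First-order optimality: [P u] is compared with nearby points of the segment from [P u] to [v],
    which stays in [C]. *)
Lemma metric_projection_inner_le0 (C : set V) P u v :
  convex_set_ C -> is_metric_projection C P -> C v -> ip (u - P u) (v - P u) <= 0.
Proof.
move=> cvxC /(_ u)[CPu Pmin] Cv.
set w := u - P u; set d := v - P u.
have diffE t : u - (t *: v + (1 - t) *: P u) = w - t *: d.
  by rewrite /w /d scalerBl scale1r scalerBr addrCA opprD addrA.
clearbody d; have {Pmin} : forall t, 0 < t -> t <= 1 -> `|w| <= `|w - t *: d|.
  by move=> t t0 t1; rewrite -diffE; exact/Pmin/cvxC/t1/ltW.
clearbody w => Pmin.
have tP (t : R) : 0 < t -> t <= 1 -> 2 * ip w d <= t * `|d| ^+ 2.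
  move=> t0 t1; have := Pmin _ t0 t1.
  rewrite -(@ler_pXn2r _ 2)// ?nnegrE// -!inner_norm !(psdE inner_psd).
  rewrite (psdC inner_psd d w) => ineq.
  by rewrite -(ler_pM2l t0); lra.
rewrite leNgt; apply/negP => wd0.
have d0 : 0 < `|d| ^+ 2.
  have := tP 1 ltr01 (lexx _); lra.
(* If [ip w d > 0], this [t] gives [2 * ip w d <= ip w d]; the minimum with 1 keeps the point on the
   segment. *)
have := tP (Num.min 1 (ip w d / `|d| ^+ 2)).
rewrite lt_min ltr01 divr_gt0//= ge_min lexx => /(_ isT isT).
have : Num.min 1 (ip w d / `|d| ^+ 2) <= ip w d / `|d| ^+ 2.
  by rewrite ge_min lexx orbT.
rewrite -(ler_pM2r d0) divfK ?gt_eqF//; lra.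
Qed.

Lemma metric_projection_firmly_nonexpansive (C : set V) P u v :
  convex_set_ C -> is_metric_projection C P ->
  0 <= ip (P u - P v) (u - v - (P u - P v)).
Proof.
move=> cvxC projP.
have := metric_projection_inner_le0 u cvxC projP (projP v).1.
have := metric_projection_inner_le0 v cvxC projP (projP u).1.
rewrite !(psdE inner_psd) !(psdC inner_psd _ (P v)) !(psdC inner_psd _ (P u)).
lra.
Qed.

End InnerProduct.

(** * Lipschitz maps, contractions and perturbed recursions *)

Lemma Lipschitz_constant_gt0 (R : realType) (V : normedModType R) (L : R) (T : V -> V) :
  lipschitz_op L T -> exists2 L' : R, 0 < L' & lipschitz_op L' T.
Proof.
move=> lipT; exists (`|L| + 1) => [|u v]; first by rewrite ltr_wpDl.
apply: le_trans (lipT u v) _; rewrite ler_wpM2r//.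
by apply: le_trans (ler_norm L) _; rewrite lerDl.
Qed.

Lemma lipschitz_op_cvg (R : realType) (V : normedModType R) (L : R) (T : V -> V)
    (f : nat -> V) u :
  lipschitz_op L T -> f @ \oo --> u -> (fun k => T (f k)) @ \oo --> T u.
Proof.
move=> /Lipschitz_constant_gt0[L' L'0 lipT] /cvgrPdist_lt fu.
apply/cvgrPdist_lt => e e0; have /fu := divr_gt0 e0 L'0.
apply: filterS => k; rewrite ltr_pdivlMr// mulrC.
exact: le_lt_trans (lipT _ _).
Qed.

(* An iterate of [T] contracts the norm itself, and its unique fixed point is
   fixed by [T]. *)
Lemma equivalent_form_contraction_fixpoint (R : realType) (V : completeNormedModType R)
    (B : V -> V -> R) (c1 c2 q : R) (T : V -> V) :
  0 < c1 -> 0 < c2 -> (forall u, c1 * `|u| ^+ 2 <= B u u) ->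
  (forall u, B u u <= c2 * `|u| ^+ 2) -> 0 <= q -> q < 1 ->
  (forall u v, B (T u - T v) (T u - T v) <= q * B (u - v) (u - v)) ->
  exists p, T p = p.
Proof.
move=> c1_gt0 c2_gt0 c1B Bc2 q0 q1 ctrT.
have ctr_iter n u v : B (iter n T u - iter n T v) (iter n T u - iter n T v)
    <= q ^+ n * B (u - v) (u - v).
  elim: n => [|n IHn]; first by rewrite expr0 mul1r.
  by apply: le_trans (ctrT _ _) _; rewrite exprS -mulrA ler_wpM2l.
(* The bound 1/4 on squared norms, with [c2 / c1] paying for the change of norm, becomes the factor
   1/2 on norms. *)
have [n qn] : exists n, q ^+ n * c2 / c1 <= 4^-1.
  have /cvgr0Pnorm_le : (fun n => q ^+ n) @ \oo --> (0 : R).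
    by apply: cvg_expr; rewrite ger0_norm.
  have e0 : 0 < 4^-1 * c1 / c2 :> R by rewrite divr_gt0 ?mulr_gt0.
  move=> /(_ _ e0)[n _ /(_ n (leqnn n))]; rewrite ger0_norm ?exprn_ge0// => qn.
  by exists n; rewrite ler_pdivrMr// -ler_pdivlMr.
have ctr_n u v : `|iter n T u - iter n T v| <= 2^-1 * `|u - v|.
  rewrite -(@ler_pXn2r _ 2)// ?nnegrE ?mulr_ge0// exprMn.
  have -> : 2^-1 ^+ 2 = 4^-1 :> R by field.
  apply: le_trans (_ : (q ^+ n * c2 / c1) * `|u - v| ^+ 2 <= _); last first.
    by rewrite ler_wpM2r// sqr_ge0.
  rewrite mulrAC ler_pdivlMr// mulrC.
  apply: le_trans (c1B _) _; apply: le_trans (ctr_iter _ _ _) _.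
  by rewrite -mulrA ler_wpM2l ?exprn_ge0.
have half_ge0 : 0 <= 2^-1 :> R by rewrite invr_ge0.
have ctr : is_contraction [fun of totalfun (iter n T)].
  exists (NngNum half_ge0); split => /=; first by rewrite invf_lt1// ltr1n.
  by move=> [u v] _; exact: ctr_n.
have [p _ /= fixp] := banach_fixed_point ctr closedT (ex_intro _ 0 I).
exists p; apply: (contraction_fixpoint_unique ctr) => //=.
by rewrite /totalfun_ -iterSr iterS; congr T.
Qed.

(* Let [e / 2] bound [eps].  Once [a k <= e], this persists; otherwise [a]
   decreases by at least [t k * (e / 2)] at each step, which the divergence of
   the series excludes. *)
Lemma cvg_perturbed_contraction (R : realType) (a t eps : nat -> R) :
  (forall k, 0 <= a k) -> (\forall k \near \oo, 0 <= t k <= 1) ->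
  (\forall k \near \oo, a k.+1 <= (1 - t k) * a k + t k * eps k) ->
  series t @ \oo --> +oo -> eps @ \oo --> 0 -> a @ \oo --> 0.
Proof.
move=> a0 t01 arec tdiv /cvgr0Pnorm_le eps0; apply/cvgr0Pnorm_le => e e0.
have e2 : 0 < e / 2 by rewrite divr_gt0.
have [N _ NP] : \forall k \near \oo, 0 <= t k <= 1 /\
    a k.+1 <= (1 - t k) * a k + t k * (e / 2).
  near=> k; have /andP[tk0 tk1] : 0 <= t k <= 1 by near: k.
  split; first by rewrite tk0.
  have : `|eps k| <= e / 2 by near: k; exact: eps0.
  move=> /(le_trans (ler_norm _)) /(ler_wpM2l tk0).
  have : a k.+1 <= (1 - t k) * a k + t k * eps k by near: k.
  lra.
have [k0 Nk0 ak0] : exists2 k0, (N <= k0)%N & a k0 <= e.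
  apply: contrapT => noK.
  have big k : (N <= k)%N -> e < a k.
    by move=> Nk; rewrite ltNge; apply/negP => ak; apply: noK; exists k.
  have dec n : a (N + n)%N <= a N - (e / 2) * (series t (N + n)%N - series t N).
    elim: n => [|n IHn]; first by rewrite addn0 subrr mulr0 subr0.
    have /NP[/andP[tk0 tk1] reck] := leq_addr n N.
    rewrite addnS seriesS/=; have /ltW/(ler_wpM2l tk0) := big _ (leq_addr n N).
    lra.
  (* Past this threshold [dec] would force a value of [a] to be at most [- (e / 2)]. *)
  have /cvgryPge/(_ (series t N + a N / (e / 2) + 1))[M _ MP] := tdiv.
  have := dec M; have := MP (N + M)%N (leq_addl N M); rewrite /=.
  rewrite -(ler_pM2l e2) !mulrDr mulrCA divff ?gt_eqF//.
  have := a0 (N + M)%N; lra.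
exists k0 => // k /= k0k; rewrite ger0_norm// -(subnKC k0k).
elim: (k - k0)%N => [|n IHn]; first by rewrite addn0.
have /NP[/andP[tk0 tk1] reck] := leq_trans Nk0 (leq_addr n k0).
rewrite addnS; have tk1' : 0 <= 1 - t (k0 + n)%N by lra.
have := ler_wpM2l tk1' IHn; have := mulr_ge0 tk0 (ltW e2); lra.
Unshelve. all: by end_near. Qed.

(** Cauchy-Schwarz on the right-hand side, then division by the square root of [B u u]. It turns
    [regularized_gvi_gap] into a distance estimate along the path. *)
Lemma sqrt_psd_gap_le (R : realType) (V : lmodType R) (B : V -> V -> R) (a b : R) u v :
  psd_form B -> 0 < a -> a * B u u <= b * B u v ->
  Num.sqrt (B u u) <= `|b| / a * Num.sqrt (B v v).
Proof.
move=> psdB a0 ineq; have Bu := psd_ge0 psdB u.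
have [->|Bu0] := eqVneq (B u u) 0.
  by rewrite sqrtr0 mulr_ge0 ?sqrtr_ge0// divr_ge0// ltW.
have su0 : 0 < Num.sqrt (B u u) by rewrite sqrtr_gt0 lt0r Bu0.
rewrite mulrAC ler_pdivlMr// -(ler_pM2r su0) mulrAC -expr2 sqr_sqrtr// mulrC.
apply: le_trans ineq _; rewrite -mulrA; apply: le_trans (ler_norm _) _.
rewrite normrM ler_wpM2l// -sqrtrM ?(psd_ge0 psdB)// -sqrtr_sqr ler_wsqrtr//.
by rewrite [leRHS]mulrC (psd_Cauchy_Schwarz psdB).
Qed.

(** * The regularized problem: contraction, solvability and the path of solutions *)

Section RegularizedGVI.
Context {R : realType} {V : completeNormedModType R} (ip : V -> V -> R)
  (C : set V) (P A F : V -> V) (lam LA LF : R).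
Hypotheses (hip : is_inner_product ip) (clC : closed C) (cvxC : convex_set_ C)
  (projP : is_metric_projection C P) (linA : is_linear_op A)
  (sadjA : self_adjoint ip A) (lam_gt0 : 0 < lam)
  (smonA : strongly_monotone ip lam A) (LA_gt0 : 0 < LA) (lipA : lipschitz_op LA A)
  (LF_gt0 : 0 < LF) (lipF : lipschitz_op LF F) (monAF : monotone_couple ip A F).

Let psd_ip := inner_psd hip.

Definition energy u v := ip (A u) v.

Definition regularize (a : R) (u : V) := F u + a *: u.

Definition gvi_step (a m h : R) (u : V) :=
  u + h *: (P (regularize a u - m *: A u) - regularize a u).

Lemma linear_opB u v : A (u - v) = A u - A v.
Proof. by have := linA (-1) v u; rewrite !scaleN1r addrC => ->; rewrite addrC. Qed.

Lemma linear_op0 : A 0 = 0.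
Proof. by have := linear_opB 0 0; rewrite !subrr. Qed.

Lemma energyBl u v w : energy (u - v) w = ip (A u - A v) w.
Proof. by rewrite /energy linear_opB. Qed.

Lemma energy_lower u : lam * `|u| ^+ 2 <= energy u u.
Proof.
by have := smonA u 0; rewrite linear_op0 !subr0.
Qed.

Lemma energy_upper u : energy u u <= LA * `|u| ^+ 2.
Proof.
apply: le_trans (inner_le_norm hip _ _) _; rewrite expr2 mulrA ler_wpM2r//.
by have := lipA u 0; rewrite linear_op0 !subr0.
Qed.

Lemma energy_psd : psd_form energy.
Proof.
split=> [u v|a u v w|u].
- by rewrite /energy (psdC psd_ip) sadjA.
- by rewrite /energy linA !(psdE psd_ip).
- by apply: le_trans (energy_lower u); rewrite mulr_ge0 ?sqr_ge0// ltW.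
Qed.

Lemma strongly_monotone_op_inj : injective A.
Proof.
move=> u v Auv; apply/subr0_eq/normr0_eq0/eqP; rewrite -sqrf_eq0.
have := energy_lower (u - v); rewrite energyBl Auv subrr (psd0l psd_ip).
by rewrite pmulr_rle0// => n0; rewrite eq_le n0 sqr_ge0.
Qed.

Lemma lipschitz_regularize a : 0 <= a -> lipschitz_op (LF + a) (regularize a).
Proof.
move=> a0 u v; rewrite /regularize opprD addrACA -scalerBr mulrDl.
by apply: le_trans (ler_normD _ _) _; rewrite lerD// normrZ ger0_norm.
Qed.

(** The energy of [e + h *: d] is expanded. Firm nonexpansiveness of [P] and monotonicity of the
    couple control the cross term; the condition on [L] absorbs [|G|^2], and [m * h * LA <= 1]
    absorbs the term quadratic in [h]. *)
Lemma gvi_step_contraction a m h L u v :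
  0 < m -> 0 <= h -> lipschitz_op L (regularize a) ->
  m * h * LA <= 1 -> L ^+ 2 <= lam * m * a ->
  energy (gvi_step a m h u - gvi_step a m h v) (gvi_step a m h u - gvi_step a m h v)
    <= (1 - h * a) * energy (u - v) (u - v).
Proof.
move=> m0 h0 lipL mhLA L2.
set wu := regularize a u - m *: A u; set wv := regularize a v - m *: A v.
set G := regularize a u - regularize a v; set e := u - v.
pose d := (P wu - regularize a u) - (P wv - regularize a v).
have -> : gvi_step a m h u - gvi_step a m h v = e + h *: d.
  rewrite /gvi_step -/wu -/wv /d /e; move: (P wu - _) (P wv - _) => du dv.
  by rewrite opprD addrACA -scalerBr.
have yE : P wu - P wv = d + G.
  rewrite /d /G; move: (P wu) (P wv) (regularize a u) (regularize a v) => yu yv fu fv.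
  by rewrite opprB addrAC !addrA !subrK.
have wE : wu - wv = G - m *: A e.
  rewrite /wu /wv /G /e linear_opB scalerBr.
  move: (m *: A u) (m *: A v) (regularize a u) (regularize a v) => bu bv fu fv.
  by rewrite !opprD !opprK addrACA.
have proj_mono := metric_projection_firmly_nonexpansive hip wu wv cvxC projP.
have G_le : `|G| ^+ 2 <= L ^+ 2 * `|e| ^+ 2.
  by rewrite -exprMn ler_pXn2r// ?nnegrE ?(le_trans _ (lipL u v))//; exact: lipL.
have e_le := energy_lower e.
have mono : a * energy e e <= ip (A e) G.
  have := monAF u v; rewrite -linear_opB -/e /energy.
  have -> : G = (F u - F v) + a *: e.
    by rewrite /G /regularize opprD addrACA -scalerBr.
  by rewrite (psdDr psd_ip (F u - F v)) (psdZr psd_ip); lra.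
have d_le := energy_upper d.
rewrite yE wE in proj_mono.
(* Nonnegativity of [|d + G|^2] removes the product of [d] and [G] from [proj_mono], at the price of
   one [|d|^2] and one [|G|^2]. *)
have young := psd_ge0 psd_ip (d + G).
have en_ge0 := psd_ge0 energy_psd e.
have psd_en := energy_psd.
clearbody G e d; clear yE wE wu wv lipL.
move: proj_mono young; rewrite !(psdE psd_ip) -/(energy e _) !(inner_norm hip).
rewrite !(psdE psd_en) (psdC psd_en d e) (psdC psd_ip G d) !(psdC psd_ip _ (A e)).
rewrite -/(energy e d) => proj young.
rewrite -(ler_pM2l m0).
have key : 2 * m * energy e d <= - `|d| ^+ 2 + `|G| ^+ 2 - 2 * m * a * energy e e.
  have := ler_wpM2l (ltW m0) mono; lra.
have G_le' : `|G| ^+ 2 <= m * a * energy e e.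
  apply: le_trans G_le _.
  apply: le_trans (_ : lam * m * a * `|e| ^+ 2 <= _).
    by rewrite ler_wpM2r ?sqr_ge0.
  have : 0 <= m * a.
    by rewrite -(pmulr_rge0 _ lam_gt0) mulrA (le_trans _ L2)// sqr_ge0.
  by move=> /ler_wpM2l/(_ _ _ e_le); lra.
have hd_le : m * h ^+ 2 * energy d d <= h * `|d| ^+ 2.
  have mh : 0 <= m * h ^+ 2 by rewrite mulr_ge0 ?sqr_ge0// ltW.
  have hd : 0 <= h * `|d| ^+ 2 by rewrite mulr_ge0 ?sqr_ge0.
  have := ler_wpM2l mh d_le; have := ler_wpM2l hd mhLA; lra.
have := ler_wpM2l h0 key; have := ler_wpM2l h0 G_le'; lra.
Qed.

Lemma gvi_step_fixed a m h u : 0 < m -> h != 0 ->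
  gvi_step a m h u = u <-> GVI_sol ip A (regularize a) C u.
Proof.
move=> m0 h0; rewrite /gvi_step /GVI_sol /=; set f := regularize a u.
set w := f - m *: A u.
have fixP : u + h *: (P w - f) = u <-> P w = f.
  split=> [|->]; last by rewrite subrr scaler0 addr0.
  move=> /(congr1 (fun z => - u + z)); rewrite addKr addNr => /eqP.
  by rewrite scaler_eq0 (negbTE h0)/= subr_eq0 => /eqP.
rewrite fixP; split=> [Pwf|[Cf sol]].
  split=> [|v Cv]; first by rewrite -Pwf; exact: (projP w).1.
  have := metric_projection_inner_le0 hip w cvxC projP Cv.
  rewrite Pwf /w [f - _]addrC addrK (psdNl psd_ip) (psdZl psd_ip).
  by rewrite oppr_le0 pmulr_rge0.
(* The projection inequality tested at [f] and the variational inequality tested at [P w] add up to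
   [|P w - f|^2 <= 0]. *)
have le1 := metric_projection_inner_le0 hip w cvxC projP Cf.
have := sol _ (projP w).1; move=> /(ler_wpM2l (ltW m0)); rewrite mulr0.
move: le1; have -> : w - P w = - (P w - f) - m *: A u by rewrite opprB {1}/w addrAC.
rewrite -(opprB (P w) f); move: (P w - f) (@subr0_eq _ (P w) f) => g g0.
rewrite !(psdE psd_ip) (inner_norm hip) => le1 le2; apply/g0/normr0_eq0/eqP.
by rewrite -sqrf_eq0 eq_le sqr_ge0 andbT; lra.
Qed.

Lemma regularized_gvi_solvable a : 0 < a -> exists u, GVI_sol ip A (regularize a) C u.
Proof.
move=> a0; have L0 : 0 < LF + a by rewrite addr_gt0.
(* [m] turns the Lipschitz condition into an equality; [h] then makes [m * h * LA] and [h * a]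
   positive with sum 1, so both lie below 1. *)
have [m m0 mE] : exists2 m, 0 < m & (LF + a) ^+ 2 = lam * m * a.
  exists ((LF + a) ^+ 2 / (lam * a)); first by rewrite divr_gt0 ?exprn_gt0 ?mulr_gt0.
  by rewrite mulrAC mulrC divfK// gt_eqF// mulr_gt0.
have den0 : 0 < m * LA + a by rewrite addr_gt0// mulr_gt0.
have [h h0 hE] : exists2 h, 0 < h & h * (m * LA + a) = 1.
  by exists (m * LA + a)^-1; rewrite ?invr_gt0// mulVf// gt_eqF.
have mhLA : 0 < m * h * LA by rewrite !mulr_gt0.
have ha : 0 < h * a by rewrite mulr_gt0.
have [] := @equivalent_form_contraction_fixpoint _ _ energy lam LA (1 - h * a)
  (gvi_step a m h) => //.
- exact: energy_lower.
- exact: energy_upper.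
- by lra.
- by lra.
- move=> u v; apply: (@gvi_step_contraction _ _ _ (LF + a)) => //; first exact: ltW.
  + exact/lipschitz_regularize/ltW.
  + by lra.
  + by rewrite mE.
by move=> u /gvi_step_fixed fixu; exists u; apply: fixu => //; rewrite gt_eqF.
Qed.

(** Each inequality is tested at the image of the other solution; in the sum, monotonicity of the
    couple discards the [F] terms. *)
Lemma regularized_gvi_gap a b u v :
  GVI_sol ip A (regularize a) C u -> GVI_sol ip A (regularize b) C v ->
  a * energy (u - v) (u - v) <= (b - a) * energy (u - v) v.
Proof.
move=> [Cu solu] [Cv solv].
have := solu _ Cv; have := solv _ Cu; have := monAF u v.
rewrite !energyBl /regularize !(psdE psd_ip); lra.
Qed.

Lemma regularize0 : regularize 0 = F.
Proof. by apply/funext => u; rewrite /regularize scale0r addr0. Qed.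

(** This is the gap inequality at [b = 0], divided by [a]. It yields both the uniform energy bound
    and the variational inequality at the limit. *)
Lemma regularized_gvi_energy_le0 a u z : 0 < a ->
  GVI_sol ip A (regularize a) C u -> GVI_sol ip A F C z -> energy (u - z) u <= 0.
Proof.
move=> a0 solu; rewrite -regularize0 => /(regularized_gvi_gap solu).
rewrite sub0r mulNr -mulrN ler_pM2l// -(psdNr energy_psd) -subr_le0.
by rewrite -(psdNr energy_psd) -(psdDr energy_psd) opprK subrK.
Qed.

Lemma regularized_gvi_energy_bound a u z : 0 < a ->
  GVI_sol ip A (regularize a) C u -> GVI_sol ip A F C z -> energy u u <= energy z z.
Proof.
move=> a0 solu solz; have := regularized_gvi_energy_le0 a0 solu solz.
have := psd_ge0 energy_psd (u - z).
by rewrite !(psdE energy_psd) (psdC energy_psd z u); lra.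
Qed.

(** The gap inequality makes [energy (u - v) v] nonnegative, and twice this term is exactly the
    difference of the two sides. *)
Lemma regularized_gvi_energy_gap a b u v : 0 < a -> a < b ->
  GVI_sol ip A (regularize a) C u -> GVI_sol ip A (regularize b) C v ->
  energy (u - v) (u - v) <= energy u u - energy v v.
Proof.
move=> a0 ab solu solv; have ba : 0 < b - a by rewrite subr_gt0.
have : 0 <= energy (u - v) v.
  rewrite -(pmulr_rge0 _ ba); apply: le_trans (regularized_gvi_gap solu solv).
  by rewrite mulr_ge0 ?(psd_ge0 energy_psd)// ltW.
by rewrite !(psdE energy_psd) (psdC energy_psd v u); lra.
Qed.

(* The energies [energy (p a) (p a)] increase as [a] decreases and are bounded,
   so [regularized_gvi_energy_gap] makes the path Cauchy. *)
Lemma regularized_path_cvg (p : R -> V) (alpha : nat -> R) :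
  GVI_sol ip A F C !=set0 ->
  (forall a, 0 < a -> GVI_sol ip A (regularize a) C (p a)) ->
  (forall k, 0 < alpha k) -> alpha @ \oo --> 0 ->
  cvg ((fun k => p (alpha k)) @ \oo).
Proof.
move=> [z solz] solp alpha0 /cvgr0Pnorm_lt alpha_cvg.
apply/cauchy_cvgP/cauchy_exP => e e0.
pose S := [set energy (p a) (p a) | a in [set a | 0 < a]].
have supS : has_sup S.
  split; first by exists (energy (p 1) (p 1)), 1 => //=; exact: ltr01.
  exists (energy z z) => _ [a /= a0 <-].
  exact: regularized_gvi_energy_bound (solp _ a0) solz.
have le0 : 0 < lam * e ^+ 2 by rewrite mulr_gt0 ?exprn_gt0.
(* For parameters below [b] the energy gap is less than [lam * e ^+ 2], hence the norm distance to
   [p b] is less than [e]. *)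
have [_ [b /= b0 <-] Sb] := sup_adherent le0 supS.
exists (p b); have := alpha_cvg _ b0; apply: filterS => k; rewrite gtr0_norm// => kb.
rewrite /= -ball_normE /= distrC.
rewrite -(@ltr_pXn2r _ 2)// ?nnegrE ?(ltW e0)// -(ltr_pM2l lam_gt0).
apply: le_lt_trans (energy_lower _) _.
apply: le_lt_trans
  (regularized_gvi_energy_gap (alpha0 k) kb (solp _ _) (solp _ b0)) _ => //.
have : energy (p (alpha k)) (p (alpha k)) <= sup S.
  by apply: ub_le_sup; [case: supS|exists (alpha k) => //=].
lra.
Qed.

(** Strong convergence and Lipschitz continuity let the regularized inequalities, and
    [regularized_gvi_energy_le0], pass to the limit. *)
Lemma regularized_path_limit (p : nat -> V) (alpha : nat -> R) q :
  (forall k, GVI_sol ip A (regularize (alpha k)) C (p k)) ->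
  (forall k, 0 < alpha k) -> alpha @ \oo --> 0 -> p @ \oo --> q ->
  GVI_sol ip A F C q /\
  forall z, GVI_sol ip A F C z -> 0 <= ip q (A z - A q).
Proof.
move=> solp alpha0 alpha_cvg pq.
have Fpq : (fun k => regularize (alpha k) (p k)) @ \oo --> F q.
  rewrite -regularize0 /regularize; apply: cvgD; first exact: lipschitz_op_cvg lipF pq.
  exact: cvgZ.
have Apq : (fun k => A (p k)) @ \oo --> A q by exact: lipschitz_op_cvg lipA pq.
split=> [|z solz].
  split=> [|v Cv].
    by apply: (@closed_cvg _ _ _ _ _ C clC _ _ Fpq); apply: nearW => k; case: (solp k).
  apply: cvgr_to_ge (inner_cvg hip Apq (cvgB (cvg_cst v) Fpq)) _.
  by apply: nearW => k; case: (solp k) => _; exact.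
rewrite (psdC psd_ip).
apply: cvgr_to_ge (inner_cvg hip (cvgB (cvg_cst (A z)) Apq) pq) _.
apply: nearW => k; have := regularized_gvi_energy_le0 (alpha0 k) (solp k) solz.
by rewrite energyBl -(opprB (A z)) (psdNl psd_ip) oppr_le0.
Qed.

End RegularizedGVI.

(** * Convergence of the scheme *)

Theorem theorem4p1 (R : realType) (V : completeNormedModType R)
  (ip : V -> V -> R) (C : set V) (P A F : V -> V) (lam LA LF : R)
  (alpha mu h : nat -> R) (x0 : V) (x y : nat -> V) :
  is_inner_product ip ->
  C !=set0 -> closed C -> convex_set_ C -> is_metric_projection C P ->
  is_linear_op A -> self_adjoint ip A -> 0 < lam -> strongly_monotone ip lam A ->
  lipschitz_op LA A -> lipschitz_op LF F ->
  seq_weak_weak_cont ip A -> seq_weak_weak_cont ip F ->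
  monotone_couple ip A F ->
  GVI_sol ip A F C !=set0 ->
  convex_set_ (A @` GVI_sol ip A F C) ->
  (forall k, 0 < alpha k) -> (forall k, 0 < mu k) -> (forall k, 0 < h k) ->
  series (fun k => h k * alpha k) @ \oo --> +oo ->
  (fun k => mu k * h k) @ \oo --> 0 ->
  (fun k => mu k * alpha k) @ \oo --> +oo ->
  (fun k => `|alpha k - alpha k.+1| / (h k * alpha k ^+ 2)) @ \oo --> 0 ->
  alpha @ \oo --> 0 ->
  x 0 = x0 ->
  (forall k, y k = P (F (x k) + alpha k *: x k - mu k *: A (x k))) ->
  (forall k, x k.+1 = x k + h k *: (y k - (F (x k) + alpha k *: x k))) ->
  exists udag : V,
    [/\ (A @` GVI_sol ip A F C) udag,
        (forall v, (A @` GVI_sol ip A F C) v -> 0 <= ip (inv_op A udag) (v - udag)),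
        (forall u, (A @` GVI_sol ip A F C) u ->
           (forall v, (A @` GVI_sol ip A F C) v -> 0 <= ip (inv_op A u) (v - u)) ->
           u = udag)
      & x @ \oo --> inv_op A udag].
Proof.
move=> hip C0 clC cvxC projP linA sadjA lam0 smonA lipLA lipLF _ _ monAF Sol0 _.
move=> alpha0 mu0 h0 hdiv muh mualpha dalpha alpha_cvg _ yE xE.
(* The given Lipschitz constants carry no sign, so positive ones replace them. *)
have [LA' LA'0 lipA] := Lipschitz_constant_gt0 lipLA.
have [LF' LF'0 lipF] := Lipschitz_constant_gt0 lipLF.
have psdA := energy_psd hip linA sadjA lam0 smonA.
have injA := strongly_monotone_op_inj hip linA lam0 smonA.
have invA u : inv_op A (A u) = u.
  by apply: injA; apply: (@xgetPex _ 0 [set v | A v = A u]); exists u.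
have [p solp] : {p : R -> V &
    forall a, 0 < a -> GVI_sol ip A (regularize F a) C (p a)}.
  apply: (@choice R V (fun a u => 0 < a -> GVI_sol ip A (regularize F a) C u)) => a.
  (* Choice needs a value at every real; 0 is a dummy value for [a <= 0]. *)
  have [a0|_] := ltP 0 a; last by exists 0.
  have [u solu] := regularized_gvi_solvable hip cvxC projP linA sadjA lam0 smonA
    LA'0 lipA LF'0 lipF monAF a0.
  by exists u.
have [q pq] : exists q : V, (fun k => p (alpha k)) @ \oo --> q.
  exists (lim ((fun k => p (alpha k)) @ \oo)).
  exact: (regularized_path_cvg hip linA sadjA lam0 smonA monAF Sol0 solp alpha0
    alpha_cvg).
have solpk k : GVI_sol ip A (regularize F (alpha k)) C (p (alpha k)).
  exact/solp/alpha0.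
have [solq viq] := regularized_path_limit hip clC linA sadjA lam0 smonA lipA lipF monAF
  solpk alpha0 alpha_cvg pq.
exists (A q); split.
- by exists q.
- by move=> _ [z solz <-]; rewrite invA; exact: viq.
(* The two variational inequalities, tested at each other's solution, add up against strong
   monotonicity and force [z = q]. *)
- move=> _ [z solz <-] /(_ (A q)); rewrite invA => /(_ (ex_intro2 _ _ q solq erefl)) viz.
  congr A; apply/subr0_eq/normr0_eq0/eqP; rewrite -sqrf_eq0 eq_le sqr_ge0 andbT.
  rewrite -(pmulr_rle0 _ lam0); apply: le_trans (smonA z q) _.
  rewrite (psdC (inner_psd hip)); have := viq _ solz; move: viz.
  by rewrite !(psdE (inner_psd hip)); lra.
rewrite invA.
have [z solz] := Sol0.
pose N u := Num.sqrt (energy ip A u u).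
have Ngap k : N (p (alpha k) - p (alpha k.+1)) <= `|alpha k - alpha k.+1| / alpha k * N z.
  have := sqrt_psd_gap_le psdA (alpha0 k)
    (regularized_gvi_gap hip linA monAF (solpk k) (solpk k.+1)).
  move/le_trans; apply; rewrite distrC ler_wpM2l ?divr_ge0// ?(ltW (alpha0 _))//.
  rewrite ler_wsqrtr//.
  exact: (regularized_gvi_energy_bound hip linA sadjA lam0 smonA monAF
    (alpha0 k.+1) (solpk k.+1) solz).
(* The factor [1 - h k * alpha k] acts on squared norms; its square root is at most [1 - t k]. The 2
   in [eps] cancels this half, so that [t k * eps k] is the bound in [Ngap]. *)
pose t k := 2^-1 * (h k * alpha k).
pose eps k := 2 * N z * (`|alpha k - alpha k.+1| / (h k * alpha k ^+ 2)).
have params : \forall k \near \oo, [/\ h k * alpha k <= 1, mu k * h k * LA' <= 1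
    & (LF' + alpha k) ^+ 2 <= lam * mu k * alpha k].
  near=> k.
  have ak := alpha0 k; have hk := h0 k; have mk := mu0 k.
  have ak1 : alpha k <= 1.
    apply: le_trans (ler_norm _) _; near: k.
    by move/cvgr0Pnorm_le: alpha_cvg; exact.
  have mhk1 : mu k * h k <= 1.
    apply: le_trans (ler_norm _) _; near: k.
    by move/cvgr0Pnorm_le: muh; exact.
  have mak1 : 1 <= mu k * alpha k by near: k; move/cvgryPge: mualpha; exact.
  (* Here [mu k * h k <= 1 <= mu k * alpha k]; with [alpha k <= 1] this gives
     [h k * alpha k <= 1]. *)
  have hak : h k <= alpha k by rewrite -(ler_pM2l mk); exact: le_trans mak1.
  split.
  - by rewrite mulr_ile1// ?(ltW hk) ?(ltW ak)//; exact: le_trans ak1.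
  - rewrite -ler_pdivlMr// mul1r; apply: le_trans (ler_norm _) _; near: k.
    by move/cvgr0Pnorm_le: muh; apply; rewrite invr_gt0.
  - apply: le_trans (_ : (LF' + 1) ^+ 2 <= _).
      by rewrite ler_pXn2r ?nnegrE ?addr_ge0 ?lerD2l// ltW.
    rewrite -mulrA -ler_pdivrMl//; near: k; move/cvgryPge: mualpha; exact.
have step_cvg : (fun k => N (x k - p (alpha k))) @ \oo --> 0.
  apply: (@cvg_perturbed_contraction _ _ t eps).
  - by move=> k; exact: sqrtr_ge0.
  - move: params; apply: filterS => k [ha1 _ _].
    have ha : 0 < h k * alpha k by rewrite mulr_gt0.
    by rewrite /t; apply/andP; lra.
  - move: params; apply: filterS => k [ha1 mhLA L2].
    have ha : 0 < h k * alpha k by rewrite mulr_gt0.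
    have t1 : 0 <= 1 - t k by rewrite /t; lra.
    have epsE : t k * eps k = `|alpha k - alpha k.+1| / alpha k * N z.
      by rewrite /t /eps; field; rewrite !gt_eqF.
    have contr := gvi_step_contraction hip cvxC projP linA sadjA lam0 smonA lipA monAF
      (x k) (p (alpha k)) (mu0 k) (ltW (h0 k))
      (lipschitz_regularize lipF (ltW (alpha0 k))) mhLA L2.
    have fixp : gvi_step P A F (alpha k) (mu k) (h k) (p (alpha k)) = p (alpha k).
      have hk : h k != 0 by rewrite gt_eqF.
      exact: (gvi_step_fixed A F hip cvxC projP (alpha k) _ (mu0 k) hk).2.
    have stepx : gvi_step P A F (alpha k) (mu k) (h k) (x k) = x k.+1.
      by rewrite xE yE.
    rewrite fixp stepx in contr.
    (* The triangle inequality through [p (alpha k)] separates the contraction from the drift of the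
       path. *)
    rewrite epsE; apply: le_trans (lerD _ (Ngap k)).
      rewrite -[x k.+1 - _](subrKA (p (alpha k))); exact: sqrt_psd_triangle.
    rewrite -[1 - t k]ger0_norm// -sqrtr_sqr -sqrtrM ?sqr_ge0// ler_wsqrtr//.
    apply: le_trans contr _; rewrite ler_wpM2r ?(psd_ge0 psdA)//.
    (* [(1 - t k)^2] equals [1 - h k * alpha k + (t k)^2]. *)
    by have := sqr_ge0 (t k); rewrite /t; lra.
  - have serE n : series t n = 2^-1 * series (fun k => h k * alpha k) n.
      by rewrite /series/= mulr_sumr.
    apply/cvgryPge => M; move/cvgryPge: hdiv => /(_ (2 * M)); apply: filterS => n.
    by rewrite serE; lra.
  - by rewrite -(mulr0 (2 * N z)); exact: cvgMr.
have -> : x = (fun k => (x k - p (alpha k)) + p (alpha k)).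
  by apply/funext => k; rewrite subrK.
rewrite -[q]add0r; apply: cvgD => //.
apply/cvgr0Pnorm_le => e e0.
have le0 : 0 < Num.sqrt lam * e by rewrite mulr_gt0 ?sqrtr_gt0.
move/cvgr0Pnorm_le: step_cvg => /(_ _ le0); apply: filterS => k.
rewrite ger0_norm ?sqrtr_ge0// => Nk.
rewrite -(@ler_pM2l _ (Num.sqrt lam)) ?sqrtr_gt0//; apply: le_trans Nk.
rewrite -[`|_|](ger0_norm (normr_ge0 _)) -sqrtr_sqr -sqrtrM ?(ltW lam0)// ler_wsqrtr//.
exact: energy_lower linA smonA _.
Unshelve. all: by end_near. Qed.
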